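(* Let $ABC$ be a nondegenerate triangle in the Euclidean plane and let $N$ be its Nagel point, i.e. the point of concurrence of $AD$, $BE$, $CF$, where $D$, $E$, $F$ are the points where the excircles of $\triangle ABC$ touch the sides $BC$, $CA$, $AB$, respectively. The cevians $AD$, $BE$, $CF$ through $N$ divide $\triangle ABC$ into the six triangles $T_1=NBD$, $T_2=NDC$, $T_3=NCE$, $T_4=NEA$, $T_5=NAF$, $T_6=NFB$. Let $R_i$ be the circumradius of $T_i$ for $i=1,\dots,6$. Then $R_1=R_4$, $R_2=R_5$, and $R_3=R_6$.
   Context: Here $D$ is the point at which the excircle opposite $A$ touches the side (segment) $BC$; $E$ is the point at which the excircle opposite $B$ touches side $CA$; $F$ is the point at which the excircle opposite $C$ touches side $AB$. *)

(* Defs.v *)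
From Stdlib Require Import Reals.
Open Scope R_scope.

Definition point : Type := (R * R)%type.

Definition edist (P Q : point) : R :=
  dist_euc (fst P) (snd P) (fst Q) (snd Q).

Definition lerp (P Q : point) (t : R) : point :=
  ((1 - t) * fst P + t * fst Q, (1 - t) * snd P + t * snd Q).

(** The set of [X] with [on_line P Q X] is a genuine line only when [P <> Q]. *)
Definition on_line (P Q X : point) : Prop := exists t : R, X = lerp P Q t.

Definition on_segment (P Q X : point) : Prop :=
  exists t : R, 0 <= t <= 1 /\ X = lerp P Q t.

Definition collinear (X Y Z : point) : Prop :=
  exists P Q : point, P <> Q /\ on_line P Q X /\ on_line P Q Y /\ on_line P Q Z.

(** The circle of centre [O] and radius [r] meets line [PQ] at [T] and nowhere
    else. *)
Definition tangent_at (O : point) (r : R) (P Q T : point) : Prop :=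
  forall X : point, on_line P Q X /\ edist O X = r <-> X = T.

(** The excircle of [ABC] opposite [A]: tangent to the side [BC], to the
    extension of [AB] beyond [B], and to the extension of [AC] beyond [C].
    These positions exclude the incircle and the other two excircles. *)
Definition excircle (A B C O : point) (r : R) : Prop :=
  0 < r /\
  (exists T, on_segment B C T /\ tangent_at O r B C T) /\
  (exists T, on_segment A T B /\ tangent_at O r A B T) /\
  (exists T, on_segment A T C /\ tangent_at O r A C T).

Definition extouch_point (A B C D : point) : Prop :=
  exists (O : point) (r : R),
    excircle A B C O r /\ on_segment B C D /\ tangent_at O r B C D.

Definition is_circumradius (X Y Z : point) (r : R) : Prop :=
  exists O : point, edist O X = r /\ edist O Y = r /\ edist O Z = r.

(* Main.v *)
Require Import Defs.
From Stdlib Require Import Reals.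
From Stdlib Require Import Lra Psatz.
Open Scope R_scope.

(** Comparing tangent lengths to an excircle gives
    [BD = EA = (BC + CA - AB) / 2].  The triangles [NBD] and [NEA] thus have
    equal sides opposite [N], and their angles at [N] are vertical, so by the
    law of sines they have equal circumradii.  The other two equalities follow
    by cyclic relabelling. *)

(** * Signed area, distances and collinearity *)

(** Twice the signed area of triangle [ABC]; its nonvanishing is the working form of
    nondegeneracy. *)
Definition cross (A B C : point) : R :=
  (fst B - fst A) * (snd C - snd A) - (snd B - snd A) * (fst C - fst A).

Lemma cross_rotate (A B C : point) : cross B C A = cross A B C.
Proof. unfold cross; ring. Qed.

Lemma edist_nonneg (P Q : point) : 0 <= edist P Q.
Proof. apply sqrt_pos. Qed.

Lemma edist_sqr (P Q : point) :
  edist P Q * edist P Q = (fst P - fst Q) ^ 2 + (snd P - snd Q) ^ 2.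
Proof.
  unfold edist, dist_euc; rewrite sqrt_sqrt; [unfold Rsqr; ring |].
  apply Rplus_le_le_0_compat; apply Rle_0_sqr.
Qed.

Lemma edist_sym (P Q : point) : edist P Q = edist Q P.
Proof. apply distance_symm. Qed.

Lemma sum_sqr_pos_neq (P Q : point) :
  P <> Q -> 0 < (fst P - fst Q) ^ 2 + (snd P - snd Q) ^ 2.
Proof.
  intros H.
  destruct (Req_dec (fst P) (fst Q)) as [H1 | H1];
    destruct (Req_dec (snd P) (snd Q)) as [H2 | H2]; try nra.
  exfalso; apply H; destruct P, Q; simpl in *; congruence.
Qed.

Lemma point_eq_dec (P Q : point) : {P = Q} + {P <> Q}.
Proof.
  destruct P as [p1 p2], Q as [q1 q2].
  destruct (Req_dec_T p1 q1) as [<- | H1]; [| right; congruence].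
  destruct (Req_dec_T p2 q2) as [<- | H2]; [left | right]; congruence.
Qed.

Lemma on_line_left (P Q : point) : on_line P Q P.
Proof. exists 0; destruct P; unfold lerp; simpl; f_equal; ring. Qed.

Lemma on_line_right (P Q : point) : on_line P Q Q.
Proof. exists 1; destruct Q; unfold lerp; simpl; f_equal; ring. Qed.

Lemma cross_zero_on_line (A B C : point) : A <> B -> cross A B C = 0 -> on_line A B C.
Proof.
  intros HAB Hc; pose proof (sum_sqr_pos_neq _ _ HAB) as Hp.
  destruct A as [a1 a2], B as [b1 b2], C as [c1 c2]; unfold cross in Hc; cbn [fst snd] in Hc, Hp.
  set (d := (a1 - b1) ^ 2 + (a2 - b2) ^ 2) in *.
  (* [n / d] is the parameter of the orthogonal projection of [C] onto line [AB]; the vanishing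
     cross product makes [C] its own projection. *)
  set (n := (b1 - a1) * (c1 - a1) + (b2 - a2) * (c2 - a2)).
  assert (Ht : n / d * d = n) by (field; lra).
  exists (n / d); set (t := n / d) in *; unfold lerp; simpl.
  f_equal; apply Rmult_eq_reg_r with d; try lra; apply Rminus_diag_uniq.
  - transitivity ((c1 - a1) * d - t * d * (b1 - a1)); [ring |].
    rewrite Ht; transitivity (- (b2 - a2) * 0); [rewrite <- Hc; unfold n, d; ring | ring].
  - transitivity ((c2 - a2) * d - t * d * (b2 - a2)); [ring |].
    rewrite Ht; transitivity ((b1 - a1) * 0); [rewrite <- Hc; unfold n, d; ring | ring].
Qed.

Lemma cross_neq_0 (A B C : point) : ~ collinear A B C -> cross A B C <> 0.
Proof.
  intros H Hc; apply H.
  destruct (point_eq_dec A B) as [<- | HAB].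
  - destruct (point_eq_dec A C) as [<- | HAC].
    (* All three points coincide, so any second point distinct from [A] spans a suitable line. *)
    + exists A, (fst A + 1, snd A); repeat split; try apply on_line_left.
      intros Heq; apply (f_equal fst) in Heq; simpl in Heq; lra.
    + exists A, C; auto using on_line_left, on_line_right.
  - exists A, B; auto using on_line_left, on_line_right, cross_zero_on_line.
Qed.

(** Heron's formula. The product is a difference of squares involving only squared side lengths, so
    the square roots disappear. It serves to rule out equality in the triangle inequality. *)
Lemma heron (A B C : point) (a b c : R) :
  a = edist B C -> b = edist C A -> c = edist A B ->
  (a + b + c) * (b + c - a) * (c + a - b) * (a + b - c) = 4 * cross A B C ^ 2.
Proof.
  intros -> -> ->.
  pose proof (edist_sqr B C) as Ha; pose proof (edist_sqr C A) as Hb;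
    pose proof (edist_sqr A B) as Hc.
  set (a := edist B C) in *; set (b := edist C A) in *; set (c := edist A B) in *.
  transitivity (4 * (b * b) * (c * c) - (b * b + c * c - a * a) ^ 2); [ring |].
  rewrite Ha, Hb, Hc; unfold cross; ring.
Qed.

(** * Lengths on segments and tangent lengths *)

Lemma edist_lerp_left (P Q : point) (t : R) :
  0 <= t -> edist P (lerp P Q t) = t * edist P Q.
Proof.
  intros Ht; apply Rsqr_inj.
  - apply edist_nonneg.
  - apply Rmult_le_pos; [assumption | apply edist_nonneg].
  - unfold Rsqr; replace (t * edist P Q * (t * edist P Q)) with (t * t * (edist P Q * edist P Q)) by ring.
    rewrite !edist_sqr; unfold lerp; simpl; ring.
Qed.

Lemma edist_lerp_right (P Q : point) (t : R) :
  t <= 1 -> edist (lerp P Q t) Q = (1 - t) * edist P Q.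
Proof.
  intros Ht; rewrite (edist_sym P Q), edist_sym.
  replace (lerp P Q t) with (lerp Q P (1 - t)) by (unfold lerp; f_equal; ring).
  apply edist_lerp_left; lra.
Qed.

Lemma on_segment_edist (P Q X : point) :
  on_segment P Q X -> edist P X + edist X Q = edist P Q.
Proof.
  intros [t [Ht ->]]; rewrite edist_lerp_left, edist_lerp_right by lra; ring.
Qed.

(* The reflection of [T] in the foot of the perpendicular from [O] lies on both
   the line and the circle, hence is [T]: so [OT] is perpendicular to [PQ]. *)
Lemma tangent_length_sqr (O : point) (r : R) (P Q T : point) :
  P <> Q -> tangent_at O r P Q T ->
  edist P T * edist P T = edist P O * edist P O - r * r /\
  edist Q T * edist Q T = edist Q O * edist Q O - r * r.
Proof.
  intros HPQ H.
  destruct (proj2 (H T) eq_refl) as [[t HT] Hr].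
  pose proof (sum_sqr_pos_neq _ _ HPQ) as Hp.
  set (d := (fst P - fst Q) ^ 2 + (snd P - snd Q) ^ 2) in *.
  set (k := (fst Q - fst P) * (fst O - fst T) + (snd Q - snd P) * (snd O - snd T)).
  (* [t + m] is the parameter of the foot of the perpendicular from [O], hence [t + 2 * m] that of
     the reflection of [T]. *)
  set (m := k / d).
  assert (Hm : m * d = k) by (unfold m; field; lra).
  assert (HX : lerp P Q (t + 2 * m) = T).
  { apply H; split; [eexists; reflexivity |].
    rewrite <- Hr; apply Rsqr_inj; try apply edist_nonneg; unfold Rsqr.
    rewrite !edist_sqr; rewrite HT; unfold lerp; simpl fst; simpl snd.
    unfold k, d in Hm; rewrite HT in Hm; unfold lerp in Hm; simpl fst in Hm; simpl snd in Hm.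
    apply Rminus_diag_uniq.
    match type of Hm with ?l = ?r =>
      transitivity (4 * m * (l - r)); [ring | rewrite Hm; ring]
    end. }
  assert (Hk : k = 0).
  { assert (H1 : 2 * m * (fst Q - fst P) = 0).
    { apply (f_equal fst) in HX; rewrite HT in HX; unfold lerp in HX; simpl in HX; lra. }
    assert (H2 : 2 * m * (snd Q - snd P) = 0).
    { apply (f_equal snd) in HX; rewrite HT in HX; unfold lerp in HX; simpl in HX; lra. }
    (* Take the inner product of [2m(Q - P) = 0] with [Q - P]. *)
    assert (H3 : 2 * k = 0).
    { rewrite <- Hm; transitivity
        (2 * m * (fst Q - fst P) * (fst Q - fst P) + 2 * m * (snd Q - snd P) * (snd Q - snd P));
        [unfold d; ring | rewrite H1, H2; ring]. }
    lra. }
  rewrite <- Hr, !edist_sqr.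
  unfold k in Hk.
  assert (Hf : fst T - fst P = t * (fst Q - fst P)) by (rewrite HT; unfold lerp; simpl; ring).
  assert (Hs : snd T - snd P = t * (snd Q - snd P)) by (rewrite HT; unfold lerp; simpl; ring).
  (* [PT] is orthogonal to [OT]; with [Hk], so is [QT]. Both claims are then Pythagoras with the
     right angle at [T]. *)
  assert (K1 : (fst T - fst P) * (fst O - fst T) + (snd T - snd P) * (snd O - snd T) = 0).
  { rewrite Hf, Hs; transitivity (t * 0); [rewrite <- Hk; ring | ring]. }
  split; nra.
Qed.

(** Both squared lengths equal the power of [P] with respect to the circle. *)
Lemma tangent_length_eq (O : point) (r : R) (P Q T Q' T' : point) :
  P <> Q -> P <> Q' -> tangent_at O r P Q T -> tangent_at O r P Q' T' ->
  edist P T = edist P T'.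
Proof.
  intros HQ HQ' H H'; apply Rsqr_inj; try apply edist_nonneg; unfold Rsqr.
  rewrite (proj1 (tangent_length_sqr _ _ _ _ _ HQ H)).
  now rewrite (proj1 (tangent_length_sqr _ _ _ _ _ HQ' H')).
Qed.

Lemma tangent_at_sym (O : point) (r : R) (P Q T : point) :
  tangent_at O r P Q T -> tangent_at O r Q P T.
Proof.
  intros H X; rewrite <- (H X).
  assert (Hs : forall P' Q', on_line P' Q' X -> on_line Q' P' X).
  { intros P' Q' [t ->]; exists (1 - t); unfold lerp; f_equal; ring. }
  split; intros [Hl Hd]; auto.
Qed.

(** * Position of the extouch points *)

Lemma cross_neq_0_distinct (A B C : point) :
  cross A B C <> 0 -> A <> B /\ B <> C /\ A <> C.
Proof.
  intros H; repeat split; intros ->; apply H; unfold cross; ring.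
Qed.

(** With [S], [T] the contact points on the extensions of [AB] and [AC], equal tangent lengths give
    [AB + BD = AS = AT = AC + CD]. The two equations together determine [BD] and [DC]. *)
Lemma extouch_edist (A B C D : point) :
  cross A B C <> 0 -> extouch_point A B C D ->
  edist B D + edist D C = edist B C /\ edist A B + edist B D = edist A C + edist D C.
Proof.
  intros Hc [O [r [[_ [_ [[S [HS TS]] [T [HT TT]]]]] [HD TD]]]].
  destruct (cross_neq_0_distinct _ _ _ Hc) as [HAB [HBC HAC]].
  split; [now apply on_segment_edist |].
  apply on_segment_edist in HS, HT.
  pose proof (tangent_length_eq _ _ _ _ _ _ _ HAB HAC TS TT) as EA.
  pose proof (tangent_length_eq _ _ _ _ _ _ _ HBC (not_eq_sym HAB) TD
                (tangent_at_sym _ _ _ _ _ TS)) as EB.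
  pose proof (tangent_length_eq _ _ _ _ _ _ _ (not_eq_sym HBC) (not_eq_sym HAC)
                (tangent_at_sym _ _ _ _ _ TD) (tangent_at_sym _ _ _ _ _ TT)) as EC.
  rewrite (edist_sym D C); lra.
Qed.

(** If [D] were [B] or [C], the tangent-length relation would make one side the sum of the other
    two, so Heron's product would vanish. *)
Lemma extouch_interior (A B C D : point) :
  cross A B C <> 0 -> extouch_point A B C D ->
  exists t, 0 < t < 1 /\ D = lerp B C t.
Proof.
  intros Hc HD; pose proof (extouch_edist _ _ _ _ Hc HD) as [_ E2].
  destruct HD as [O [r [_ [[t [Ht ->]] _]]]].
  exists t; split; [| reflexivity].
  rewrite edist_lerp_left, edist_lerp_right in E2 by lra.
  pose proof (heron A B C _ _ _ eq_refl eq_refl eq_refl) as Hh.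
  rewrite (edist_sym A C) in E2.
  assert (0 < 4 * cross A B C ^ 2) by (pose proof (Rsqr_pos_lt _ Hc) as H; unfold Rsqr in H; lra).
  enough (t <> 0 /\ t <> 1) by lra.
  split; intros ->.
  - replace (edist B C + edist C A - edist A B) with 0 in Hh by lra; lra.
  - replace (edist A B + edist B C - edist C A) with 0 in Hh by lra; lra.
Qed.

(** * Circumradii *)

(** The square of the classical relation: the product of the sides is four times the circumradius
    times the area. *)
Lemma circumradius_sqr (X Y Z : point) (r : R) :
  is_circumradius X Y Z r ->
  4 * r ^ 2 * cross X Y Z ^ 2 =
  (edist X Y * edist X Y) * (edist X Z * edist X Z) * (edist Y Z * edist Y Z).
Proof.
  intros [O [HX [HY HZ]]].
  pose proof (edist_sqr O X) as EX; pose proof (edist_sqr O Y) as EY;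
    pose proof (edist_sqr O Z) as EZ.
  rewrite HX in EX; rewrite HY in EY; rewrite HZ in EZ.
  rewrite !edist_sqr; unfold cross.
  destruct O as [o1 o2], X as [x1 x2], Y as [y1 y2], Z as [z1 z2]; cbn [fst snd] in *.
  set (p := (o1 - x1) * (y1 - x1) + (o2 - x2) * (y2 - x2)).
  set (q := (o1 - x1) * (z1 - x1) + (o2 - x2) * (z2 - x2)).
  set (U := (x1 - y1) ^ 2 + (x2 - y2) ^ 2).
  set (V := (x1 - z1) ^ 2 + (x2 - z2) ^ 2).
  set (w := (y1 - x1) * (z1 - x1) + (y2 - x2) * (z2 - x2)).
  (* Equidistance of [O] from [X] and [Y], then from [X] and [Z]. *)
  assert (Hp : 2 * p = U) by (unfold p, U; nra).
  assert (Hq : 2 * q = V) by (unfold q, V; nra).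
  (* Planar identity for [|u|^2 (v x w)^2] in terms of inner products, with [u = O - X].
     Substituting [U] and [V] leaves [UV(U + V - 2w)], and the last factor is [YZ^2] by the law of
     cosines. *)
  transitivity ((2 * p) ^ 2 * V - 2 * (2 * p) * (2 * q) * w + (2 * q) ^ 2 * U).
  - replace (r ^ 2) with (r * r) by ring; rewrite EX; unfold p, q, U, V, w; ring.
  - rewrite Hp, Hq; unfold U, V, w; ring.
Qed.

Lemma is_circumradius_nonneg (X Y Z : point) (r : R) : is_circumradius X Y Z r -> 0 <= r.
Proof. intros [O [<- _]]; apply edist_nonneg. Qed.

(* Law of sines for triangles with vertical angles at [N] and equal opposite
   sides. *)
Lemma circumradius_vertical (N A B D E : point) (p q r r' : R) :
  p <> 0 -> p <> 1 -> q <> 0 -> q <> 1 ->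
  N = lerp A D p -> N = lerp B E q -> cross N A B <> 0 ->
  edist B D = edist E A ->
  is_circumradius N B D r -> is_circumradius N E A r' -> r = r'.
Proof.
  intros Hp Hp1 Hq Hq1 HA HB Hc Hd Hr Hr'.
  apply Rsqr_inj; eauto using is_circumradius_nonneg; unfold Rsqr.
  apply circumradius_sqr in Hr, Hr'.
  rewrite Hd in Hr; rewrite !(edist_sqr N) in Hr, Hr'.
  set (L := edist E A * edist E A) in *.
  unfold lerp in HA, HB.
  assert (A1 : p * (fst D - fst N) = - (1 - p) * (fst A - fst N))
    by (rewrite HA; simpl; ring).
  assert (A2 : p * (snd D - snd N) = - (1 - p) * (snd A - snd N))
    by (rewrite HA; simpl; ring).
  assert (B1 : q * (fst E - fst N) = - (1 - q) * (fst B - fst N))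
    by (rewrite HB; simpl; ring).
  assert (B2 : q * (snd E - snd N) = - (1 - q) * (snd B - snd N))
    by (rewrite HB; simpl; ring).
  (* Relative to [N], [D] is [-x] times [A] and [E] is [-y] times [B]. *)
  set (x := (1 - p) / p); set (y := (1 - q) / q).
  assert (A1' : fst D = fst N - x * (fst A - fst N)).
  { apply Rmult_eq_reg_l with p; [| assumption]. unfold x; field_simplify; lra. }
  assert (A2' : snd D = snd N - x * (snd A - snd N)).
  { apply Rmult_eq_reg_l with p; [| assumption]. unfold x; field_simplify; lra. }
  assert (B1' : fst E = fst N - y * (fst B - fst N)).
  { apply Rmult_eq_reg_l with q; [| assumption]. unfold y; field_simplify; lra. }
  assert (B2' : snd E = snd N - y * (snd B - snd N)).
  { apply Rmult_eq_reg_l with q; [| assumption]. unfold y; field_simplify; lra. }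
  assert (Hx : x <> 0).
  { unfold x; apply Rmult_integral_contrapositive_currified; [lra | now apply Rinv_neq_0_compat]. }
  assert (Hy : y <> 0).
  { unfold y; apply Rmult_integral_contrapositive_currified; [lra | now apply Rinv_neq_0_compat]. }
  unfold cross in Hr, Hr'; rewrite A1', A2' in Hr; rewrite B1', B2' in Hr'.
  (* After scaling out [x ^ 2] and [y ^ 2], both circumradius equations become the same equation:
     [k] times the squared radius equals [M]. *)
  set (k := 4 * cross N A B ^ 2).
  set (M := ((fst A - fst N) ^ 2 + (snd A - snd N) ^ 2) *
            ((fst B - fst N) ^ 2 + (snd B - snd N) ^ 2) * L).
  assert (K1 : x ^ 2 * (k * (r * r)) = x ^ 2 * M).
  { match type of Hr with ?s = _ => transitivity s end;
      [unfold k, cross; ring | rewrite Hr; unfold M; ring]. }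
  assert (K2 : y ^ 2 * (k * (r' * r')) = y ^ 2 * M).
  { match type of Hr' with ?s = _ => transitivity s end;
      [unfold k, cross; ring | rewrite Hr'; unfold M; ring]. }
  apply Rmult_eq_reg_l in K1; [| now apply pow_nonzero].
  apply Rmult_eq_reg_l in K2; [| now apply pow_nonzero].
  apply Rmult_eq_reg_l with k; [congruence |].
  pose proof (Rsqr_pos_lt _ Hc) as H; unfold Rsqr in H; unfold k; lra.
Qed.

(** * Intersecting the cevians and concluding *)

(** Compares the barycentric coordinates at [A] and at [B] of the common point; these are unique
    because [ABC] is nondegenerate. *)
Lemma cevians_meet (A B C : point) (s t p q : R) :
  cross A B C <> 0 -> lerp A (lerp B C t) p = lerp B (lerp C A s) q ->
  1 - p = q * s /\ p * (1 - t) = 1 - q.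
Proof.
  intros Hc H.
  pose proof (f_equal fst H) as H1; pose proof (f_equal snd H) as H2.
  unfold lerp in H1, H2; simpl in H1, H2; clear H.
  split; apply Rmult_eq_reg_r with (cross A B C); try assumption; unfold cross;
  destruct A as [a1 a2], B as [b1 b2], C as [c1 c2]; simpl in *; clear Hc.
  - apply Rminus_diag_uniq.
    match type of H1 with ?l1 = ?r1 => match type of H2 with ?l2 = ?r2 =>
      (* Crossing the vector equation with the direction of [BC] isolates the coefficient of [A];
         the direction of [CA] does the same for [B] below. *)
      transitivity ((l1 - r1) * (b2 - c2) - (l2 - r2) * (b1 - c1));
       [ring | rewrite H1, H2; ring] end end.
  - apply Rminus_diag_uniq.
    match type of H1 with ?l1 = ?r1 => match type of H2 with ?l2 = ?r2 =>
      transitivity ((l1 - r1) * (c2 - a2) - (l2 - r2) * (c1 - a1));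
       [ring | rewrite H1, H2; ring] end end.
Qed.

Lemma nagel_opposite_circumradii (A B C D E N : point) (r r' : R) :
  cross A B C <> 0 -> extouch_point A B C D -> extouch_point B C A E ->
  on_line A D N -> on_line B E N ->
  is_circumradius N B D r -> is_circumradius N E A r' -> r = r'.
Proof.
  intros Hc HD HE [p HA] [q HB] Hr Hr'.
  assert (Hc' : cross B C A <> 0) by now rewrite cross_rotate.
  pose proof (extouch_edist _ _ _ _ Hc HD) as [D1 D2].
  pose proof (extouch_edist _ _ _ _ Hc' HE) as [E1 E2].
  destruct (extouch_interior _ _ _ _ Hc HD) as [t [Ht HDt]].
  destruct (extouch_interior _ _ _ _ Hc' HE) as [s [Hs HEs]].
  rewrite HA in HB; rewrite HDt, HEs in HB.
  destruct (cevians_meet _ _ _ _ _ _ _ Hc HB) as [P1 P2].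
  rewrite <- HDt, <- HEs, <- HA in HB.
  (* [N] is none of [A], [D], [B], [E]: by [P1] and [P2], any such coincidence would force [s = 1]
     or [t = 0]. *)
  assert (Hp : p <> 0) by (intros ->; nra).
  assert (Hq : q <> 0) by (intros ->; nra).
  assert (Hp1 : p <> 1) by (intros ->; nra).
  assert (Hq1 : q <> 1) by (intros ->; nra).
  apply (circumradius_vertical N A B D E p q); auto.
  (* [p * t] is the barycentric coordinate of [N] at [C], hence the ratio of the signed areas. *)
  - replace (cross N A B) with (p * t * cross A B C).
    + repeat apply Rmult_integral_contrapositive_currified; lra.
    + rewrite HA, HDt; unfold cross, lerp; simpl; ring.
  - rewrite (edist_sym A C), (edist_sym B A) in *; lra.
Qed.

Theorem theorem2p4 (A B C D E F N : point) (R1 R2 R3 R4 R5 R6 : R)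
  (hABC : ~ collinear A B C)
  (hD : extouch_point A B C D)
  (hE : extouch_point B C A E)
  (hF : extouch_point C A B F)
  (hAD : on_line A D N)
  (hBE : on_line B E N)
  (hCF : on_line C F N)
  (h1 : is_circumradius N B D R1)
  (h2 : is_circumradius N D C R2)
  (h3 : is_circumradius N C E R3)
  (h4 : is_circumradius N E A R4)
  (h5 : is_circumradius N A F R5)
  (h6 : is_circumradius N F B R6) :
  R1 = R4 /\ R2 = R5 /\ R3 = R6.
Proof.
  apply cross_neq_0 in hABC as HA.
  assert (HB : cross B C A <> 0) by now rewrite cross_rotate.
  assert (HC : cross C A B <> 0) by now rewrite cross_rotate.
  repeat split.
  - exact (nagel_opposite_circumradii A B C D E N _ _ HA hD hE hAD hBE h1 h4).
  (* The relabelling [C, A, B] yields the equality in the order [R5 = R2]. *)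
  - symmetry.
    exact (nagel_opposite_circumradii C A B F D N _ _ HC hF hD hCF hAD h5 h2).
  - exact (nagel_opposite_circumradii B C A E F N _ _ HB hE hF hBE hCF h3 h6).
Qed.
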